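(* Let $(\mathscr Y,\|\cdot\|_{\mathscr Y})$ be a reflexive Banach space that is a dense subspace of $\mathscr X$ and is compactly embedded in $\mathscr X$. Let $z\in L^2(0,T;\mathscr X)$ be given, let paths $p_i\in L^2(0,T;\mathcal P_i)$, $i=1,\dots,r$, be given, and let the transformation operators $\mathcal T_i\colon\mathcal P_i\to\mathcal B(\mathscr X)$ satisfy, for $i=1,\dots,r$: (i) for each $\varphi_i\in\mathscr Y$ the map $\mathcal T_i(\cdot)\varphi_i\colon\mathcal P_i\to\mathscr Y$ is continuous; (ii) there is a constant $\overline c>0$ with $\|\mathcal T_i(\eta)\|_{\mathcal B(\mathscr X)}\le\overline c$ for all $\eta\in\mathcal P_i$. Then the minimization problem $$\min J(\tilde z,\varphi)\quad\text{subject to } (\tilde z,\varphi)\in\mathcal A$$ has a solution, i.e. there is $(\tilde z^\star,\varphi^\star)\in\mathcal A$ with $J(\tilde z^\star,\varphi^\star)\le J(\tilde z,\varphi)$ for all $(\tilde z,\varphi)\in\mathcal A$.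
   Context: $\mathscr X$ is a separable real Hilbert space with norm $\|\cdot\|_{\mathscr X}$; $T>0$, $r\in\mathbb N$; $\mathcal P_i=\mathbb R^{q_i}$; $\mathcal B(\mathscr X)$ is the space of bounded linear operators on $\mathscr X$. The operators are $\mathscr Y$-invariant: $\mathcal T_i(\eta)\mathscr Y\subseteq\mathscr Y$ for all $\eta\in\mathcal P_i$. Write $\tilde z=(\tilde z_1,\dots,\tilde z_r)$ and $\varphi=(\varphi_1,\dots,\varphi_r)$. The cost functional $J\colon L^2(0,T;\mathbb R^r)\times\mathscr X^r\to\mathbb R$ is $$J(\tilde z,\varphi)=\frac12\int_0^T\Big\|z(t)-\sum_{i=1}^r\tilde z_i(t)\,\mathcal T_i(p_i(t))\varphi_i\Big\|_{\mathscr X}^2\,dt,$$ and the admissible set is $$\mathcal A=\Big\{(\tilde z,\varphi)\in L^2(0,T;\mathbb R^r)\times\mathscr X^r \ :\ \varphi\in\mathscr Y^r,\ \max\{\|\varphi_i\|_{\mathscr Y},\|\tilde z_i\|_{L^2(0,T)}\}\le C,\ \|\varphi_i\|_{\mathscr X}=1\text{ for }i=1,\dots,r\Big\},$$ where $C>0$ is a given constant that is large enough (in particular, so large that $\mathcal A\neq\emptyset$). *)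

(* Defs.v *)
From HB Require Import structures.
From mathcomp Require Import all_boot all_order all_algebra.
From mathcomp Require Import sesquilinear.
From mathcomp Require Import all_classical all_reals all_analysis.

Set Implicit Arguments.
Unset Strict Implicit.
Unset Printing Implicit Defensive.

Import Order.TTheory GRing.Theory Num.Theory.
Import numFieldNormedType.Exports.

Local Open Scope classical_set_scope.
Local Open Scope ring_scope.

Definition separable (V : topologicalType) : Prop :=
  exists2 A : set V, countable A & dense A.

(* The supremum is meaningful for bounded [f]; it is only applied to continuous
   linear maps. *)
Definition opnorm (R : realType) (V W : normedModType R) (f : V -> W) : R :=
  sup [set `|f x| | x in [set x : V | `|x| <= 1]].

Definition dual_space (R : realType) (V : normedModType R) : set (V -> R^o) :=
  [set f | linear f /\ continuous f].

(* The canonical embedding of V into its bidual is onto.  An element of the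
   bidual is represented by a function F on all maps V -> R, of which only the
   values on the dual matter. *)
Definition reflexive_space (R : realType) (V : normedModType R) : Prop :=
  forall F : (V -> R^o) -> R,
    (forall (a : R) (f g : V -> R^o), dual_space f -> dual_space g ->
       F (fun y => a *: f y + g y) = a * F f + F g) ->
    (exists M : R, forall f : V -> R^o, dual_space f -> `|F f| <= M * opnorm f) ->
  exists y : V, forall f : V -> R^o, dual_space f -> F f = f y.

(* A linear map embedding V compactly into W. *)
Definition compact_embedding (R : realType) (V W : normedModType R)
    (iota : V -> W) : Prop :=
  [/\ injective iota, continuous iota &
      forall B : set V, bounded_set B -> precompact (iota @` B)].

Section Bochner.
Context (R : realType) (V : normedModType R).
Implicit Types (D : set R) (f s : R -> V).

Definition simple_on D s : Prop :=
  finite_set (s @` D) /\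
  forall v, measurable (D `&` s @^-1` [set v] : set (measurableTypeR R)).

(* Bochner measurability.  Elements of L^2(0,T;V) are handled through
   representatives, and the measurable sets are the Borel sets, so the
   convergence is required at every point of D: each a.e.-class of a.e. limits
   of simple functions has such a representative. *)
Definition strongly_measurable D f : Prop :=
  exists s : nat -> R -> V,
    (forall n, simple_on D (s n)) /\
    (forall t, D t -> s n t @[n --> \oo] --> f t).

Definition L2 (T : R) (f : R -> V) : Prop :=
  strongly_measurable `]0, T[ f /\
  (\int[lebesgue_measure]_(t in `]0%R, T[) (`|f t| ^+ 2)%:E < +oo)%E.

End Bochner.

Definition L2norm (R : realType) (T : R) (f : R -> R) : R :=
  Num.sqrt (\int[lebesgue_measure]_(t in `]0, T[) (`|f t| ^+ 2)).

Section Problem.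
Context (R : realType) (X Y : normedModType R) (r : nat) (q : 'I_r -> nat).

(* A pair u = (ztilde, phi) in L^2(0,T;R^r) x X^r.  The norm of 'rV[R]_n in the
   library is the maximum norm, equivalent to the Euclidean one. *)
Definition J (T : R) (z : R -> X) (p : forall i, R -> 'rV[R]_(q i))
    (Top : forall i, 'rV[R]_(q i) -> X -> X)
    (u : (R -> 'rV[R]_r) * ('I_r -> X)) : R :=
  2^-1 * \int[lebesgue_measure]_(t in `]0, T[)
    (`| z t - \sum_(i < r) u.1 t ord0 i *: Top i (p i t) (u.2 i) | ^+ 2).

(* Y is seen as a subspace of X through the embedding iota, so that
   "phi_i in Y" means phi_i = iota psi_i, and the Y-norm of phi_i is that of
   psi_i. *)
Definition admissible (T C : R) (iota : Y -> X) :
    set ((R -> 'rV[R]_r) * ('I_r -> X)) :=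
  [set u : (R -> 'rV[R]_r) * ('I_r -> X) | L2 T u.1 /\
    exists psi : 'I_r -> Y, forall i : 'I_r,
      [/\ u.2 i = iota (psi i),
          Num.max `|psi i| (L2norm T (fun t => u.1 t ord0 i)) <= C &
          `|u.2 i| = 1]].

End Problem.

(* Main.v *)
(* The two variables decouple. For fixed modes phi the residual is affine in
   ztilde, so J is convex there; among almost J-minimal ztilde, those of almost
   minimal L^2 norm form a Cauchy sequence by the parallelogram identity, and
   Fatou's lemma along an a.e. convergent sequence yields a minimizer w(phi). No weak
   compactness in L^2 is needed. On the other hand sqrt J is Lipschitz in phi for
   the X-norm, uniformly for ztilde in the admissible ball, because the operators
   are uniformly bounded; so along an ultrafilter on which the modes of a
   minimizing sequence converge in X to some phi, the value J(w(phi), phi) is at most the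
   infimum. That the limit phi is admissible uses reflexivity: the limit of the
   Y-preimages tested against the dual of Y defines an element of the bidual,
   hence a point y of Y, and norming functionals (Hahn-Banach) give |y| <= C and
   iota y = phi. *)

Require Import Defs.
From HB Require Import structures.
From mathcomp Require Import all_boot all_order all_algebra.
From mathcomp Require Import sesquilinear.
From mathcomp Require Import all_classical all_reals all_analysis.
From mathcomp Require Import measurable_realfun ring lra.

Set Implicit Arguments.
Unset Strict Implicit.
Unset Printing Implicit Defensive.

Import Order.TTheory GRing.Theory Num.Theory.
Import numFieldNormedType.Exports.

Local Open Scope classical_set_scope.
Local Open Scope ring_scope.

(** * Norming functionals *)

Section SublinearFunctionals.
Context (R : realType) (V : lmodType R).
Implicit Types (p : V -> R) (x v w : V).

Definition sublinear p : Prop :=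
  (forall v w, p (v + w) <= p v + p w) /\
  (forall a v, 0 <= a -> p (a *: v) <= a * p v).

Lemma sublinear0 p : sublinear p -> p 0 = 0.
Proof.
move=> [pD pZ]; apply/eqP; rewrite eq_le; apply/andP; split.
  by have := pZ 0 0 (lexx _); rewrite scale0r mul0r.
by have := pD 0 0; rewrite addr0; lra.
Qed.

Lemma sublinearZ p a v : sublinear p -> 0 <= a -> p (a *: v) = a * p v.
Proof.
move=> sp; have [_ pZ] := sp; rewrite le_eqVlt => /predU1P[<-|a0].
  by rewrite scale0r mul0r sublinear0.
apply/eqP; rewrite eq_le pZ ?(ltW a0)//=. rewrite -ler_pdivlMl//.
by have := pZ a^-1 (a *: v); rewrite scalerA mulVf ?gt_eqF// scale1r invr_ge0 ltW//; apply.
Qed.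

Lemma sublinearN p v : sublinear p -> - p (- v) <= p v.
Proof.
move=> sp; have := sp.1 v (- v); rewrite subrr sublinear0//; lra.
Qed.

(** For sublinear [p] this is the largest sublinear functional below [p] whose value at [- x] is at
    most [- p x]; [t = 0] gives the first bound and [t = 1] the second. *)
Definition sublin_shift p x v : R :=
  inf [set p (v + t *: x) - t * p x | t in [set t | 0 <= t]].

Let shift_lb p x v : sublinear p ->
  lbound [set p (v + t *: x) - t * p x | t in [set t | 0 <= t]] (- p (- v)).
Proof.
move=> sp _ [t /= t0 <-].
have := sp.1 (v + t *: x) (- v); rewrite addrAC subrr add0r sublinearZ//; lra.
Qed.

Lemma sublin_shift_le p x v t : sublinear p -> 0 <= t ->
  sublin_shift p x v <= p (v + t *: x) - t * p x.
Proof.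
move=> sp t0; apply: ge_inf; last by exists t.
by exists (- p (- v)); exact: shift_lb.
Qed.

Lemma le_sublin_shift p x v c :
  (forall t, 0 <= t -> c <= p (v + t *: x) - t * p x) -> c <= sublin_shift p x v.
Proof.
move=> h; apply: lb_le_inf; first by exists (p (v + 0 *: x) - 0 * p x), 0 => /=.
by move=> _ [t /= t0 <-]; exact: h.
Qed.

(** Parameters [s] for [w] and [t] for [v] add up to a parameter for [v + w], and scaling by [a > 0]
    turns [t] into [a * t]. *)
Lemma sublinear_shift p x : sublinear p -> sublinear (sublin_shift p x).
Proof.
move=> sp; split=> [v w|a v].
- rewrite -lerBlDr; apply: le_sublin_shift => t t0.
  rewrite lerBlDr [leRHS]addrC -lerBlDr; apply: le_sublin_shift => s s0.
  rewrite lerBlDr; apply: (le_trans (sublin_shift_le x (v + w) sp (addr_ge0 s0 t0))).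
  have := sp.1 (w + s *: x) (v + t *: x); rewrite addrACA -scalerDl (addrC w).
  rewrite mulrDl; lra.
- rewrite le_eqVlt => /predU1P[<-|a0].
    rewrite scale0r mul0r; apply: (le_trans (sublin_shift_le x 0 sp (lexx 0))).
    by rewrite scale0r addr0 mul0r subr0 sublinear0.
  rewrite -ler_pdivrMl//; apply: le_sublin_shift => t t0; rewrite ler_pdivrMl//.
  have at0 : 0 <= a * t by rewrite mulr_ge0// ltW.
  apply: (le_trans (sublin_shift_le x (a *: v) sp at0)).
  by rewrite -scalerA -scalerDr sublinearZ ?(ltW a0)// mulrBr mulrA.
Qed.

(* A minimal sublinear functional q coincides with all its shifts, so
   q (- x) <= - q x for every x. *)
Lemma hahn_banach p : sublinear p ->
  exists2 f : V -> R^o, linear f & forall v, f v <= p v.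
Proof.
move=> sp.
pose S := {q : V -> R | sublinear q /\ forall v, q v <= p v}.
(* The order is reversed, so the maximal element given by Zorn's lemma is a minimal sublinear
   functional. *)
pose rel (q1 q2 : S) := `[< forall v, sval q2 v <= sval q1 v >].
(* A lower bound common to all of [S], which makes the pointwise infimum over a chain a genuine
   one. *)
have lbS (q : S) v : - p (- v) <= sval q v.
  case: q => q [sq qp] /=; have := qp (- v); have := sublinearN v sq; lra.
have [||A Atot|[q [sq qp]] qmin] := @ZL_preorder S (exist _ p (conj sp (fun v => lexx (p v)))) rel.
- by move=> q; apply/asboolP => v.
- by move=> q1 q2 q3 /asboolP h1 /asboolP h2; apply/asboolP => v; exact: le_trans (h1 v).
- have [->|/set0P[q0 Aq0]] := eqVneq A set0.
    by exists (exist _ p (conj sp (fun v => lexx (p v)))) => s [].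
  pose m v := inf [set sval q v | q in A].
  have mle q v : A q -> m v <= sval q v.
    move=> Aq; apply: ge_inf; last by exists q.
    by exists (- p (- v)) => _ [s _ <-].
  have mge v c : (forall q, A q -> c <= sval q v) -> c <= m v.
    move=> h; apply: lb_le_inf; first by exists (sval q0 v), q0.
    by move=> _ [q Aq <-]; exact: h.
  have sm : sublinear m.
    split=> [v w|a v].
    + rewrite -lerBlDr; apply: (mge _ _) => q Aq.
      rewrite lerBlDr [leRHS]addrC -lerBlDr. apply: (mge _ _) => q' Aq'; rewrite lerBlDr.
      (* Totality of the chain: the smaller of [q] and [q'] handles both summands at once. *)
      have [/asboolP h|/asboolP h] := Atot _ _ Aq Aq'.
      * apply: (le_trans (mle _ _ Aq')); apply: (le_trans ((svalP q').1.1 v w)).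
        by rewrite addrC lerD2l.
      * apply: (le_trans (mle _ _ Aq)); apply: (le_trans ((svalP q).1.1 v w)).
        by rewrite addrC lerD2r.
    + rewrite le_eqVlt => /predU1P[<-|a0].
        rewrite scale0r mul0r; apply: (le_trans (mle _ _ Aq0)).
        by rewrite sublinear0//; exact: (svalP q0).1.
      rewrite -ler_pdivrMl//; apply: (mge _ _) => q Aq; rewrite ler_pdivrMl//.
      apply: (le_trans (mle _ _ Aq)); apply: (svalP q).1.2; exact: ltW.
  have mp v : m v <= p v := le_trans (mle _ v Aq0) ((svalP q0).2 v).
  by exists (exist _ m (conj sm mp)) => s As; apply/asboolP => v /=; exact: mle.
- have qshift x v : q v <= sublin_shift q x v.
    have shp w : sublin_shift q x w <= q w.
      by have := sublin_shift_le x w sq (lexx 0); rewrite scale0r addr0 mul0r subr0.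
    have shS : sublinear (sublin_shift q x) /\ forall w, sublin_shift q x w <= p w.
      by split; [exact: sublinear_shift | move=> w; exact: le_trans (shp w) _].
    by have /(_ _)/asboolP/(_ v) := qmin (exist _ _ shS); apply; apply/asboolP.
  have qN x : q (- x) = - q x.
    apply/eqP; rewrite eq_le; apply/andP; split.
      have := le_trans (qshift x (- x)) (sublin_shift_le x (- x) sq ler01).
      by rewrite scale1r addNr sublinear0// sub0r mul1r.
    by have := sublinearN (- x) sq; rewrite opprK.
  have qD v w : q (v + w) = q v + q w.
    apply/eqP; rewrite eq_le sq.1/=.
    by have := sq.1 (v + w) (- w); rewrite addrK qN; lra.
  exists q => // a v w; rewrite qD; congr (_ + _).
  have [a0|/ltW a0] := leP 0 a; first by rewrite sublinearZ.
  by rewrite -[a]opprK scaleNr qN sublinearZ ?oppr_ge0// scaleNr.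
Qed.

End SublinearFunctionals.

(** The dominating functional is the shift of the norm at [y]. It lies below the norm, and its value
    at [- y] is at most [- |y|], which forces [f y >= |y|]. *)
Lemma norming_functional (R : realType) (V : normedModType R) (y : V) :
  exists f : V -> R^o,
    [/\ linear f, f y = `|y| & forall v, `|f v| <= `|v|].
Proof.
have sn : sublinear (fun v : V => `|v|).
  by split=> [v w|a v a0]; [exact: ler_normD | rewrite normrZ ger0_norm].
have [f lf fle] := hahn_banach (sublinear_shift y sn).
have fN v : f (- v) = - f v.
  have f0 : f 0 = 0.
    by have := lf 1 0 0; rewrite !scale1r addr0; move/eqP; rewrite -subr_eq subrr => /eqP.
  by have := lf (-1) v 0; rewrite !scaleN1r f0 !addr0.
have fn v : f v <= `|v|.
  apply: (le_trans (fle v)).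
  by have := sublin_shift_le y v sn (lexx 0); rewrite scale0r addr0 mul0r subr0.
exists f; split=> //.
  apply/eqP; rewrite eq_le fn/=.
  have := le_trans (fle (- y)) (sublin_shift_le y (- y) sn ler01).
  by rewrite fN scale1r addNr normr0 mul1r sub0r lerN2.
by move=> v; rewrite ler_norml fn andbT lerNl -fN -(normrN v) fn.
Qed.

(** * Limits in reflexive and compactly embedded spaces *)

(** A cluster point along an ultrafilter is a limit: either the preimage of a neighbourhood or its
    complement is in [U], and the latter contradicts clustering. *)
Lemma ultra_cvg_compact (I : Type) (T : topologicalType) (U : set_system I)
    (K : set T) (f : I -> T) :
  UltraFilter U -> compact K -> (forall i, K (f i)) ->
  exists2 x, K x & f i @[i --> U] --> x.
Proof.
move=> UU cK Kf.
have UK : U (f @^-1` K) by apply: filterS filterT => i _; exact: Kf.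
have [x [Kx clx]] := cK (f i @[i --> U]) _ UK.
exists x => // A Ax; have [//|UA] := in_ultra_setVsetC (f @^-1` A) UU.
by have [t []] := clx (~` A) A UA Ax.
Qed.

Lemma linear_norm_bound (R : realType) (V W : normedModType R) (f : V -> W) :
  linear f -> continuous f -> exists2 M, 0 < M & forall x, `|f x| <= M * `|x|.
Proof.
move=> lf cf.
pose g : {linear V -> W} := HB.pack f (GRing.isLinear.Build R V W _ f lf).
have /linear_bounded_continuous/linear_boundedP : continuous g by [].
by move=> /pinfty_ex_gt0[M M0 gM]; exists M.
Qed.

Lemma opnorm_ub (R : realType) (V W : normedModType R) (f : V -> W) x :
  linear f -> continuous f -> `|x| <= 1 -> `|f x| <= opnorm f.
Proof.
move=> lf cf x1; have [M M0 fM] := linear_norm_bound lf cf.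
apply: ub_le_sup; last by exists x.
by exists M => _ [v /= v1 <-]; rewrite (le_trans (fM v))// ger_pMr.
Qed.

Lemma opnorm_ge0 (R : realType) (V W : normedModType R) (f : V -> W) :
  linear f -> continuous f -> 0 <= opnorm f.
Proof.
by move=> lf cf; rewrite (le_trans (normr_ge0 (f 0)))// opnorm_ub// normr0.
Qed.

Lemma le_opnorm (R : realType) (V W : normedModType R) (f : V -> W) x :
  linear f -> continuous f -> `|f x| <= opnorm f * `|x|.
Proof.
move=> lf cf; have [x0|x0] := eqVneq x 0.
  have [M _ /(_ x)] := linear_norm_bound lf cf.
  by rewrite x0 normr0 !mulr0.
have fZ a v : f (a *: v) = a *: f v.
  pose g : {linear V -> W} := HB.pack f (GRing.isLinear.Build R V W _ f lf).
  by rewrite -[LHS]/(g (a *: v)) linearZ.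
rewrite -ler_pdivrMr ?normr_gt0//.
have := @opnorm_ub _ _ _ f (`|x|^-1 *: x) lf cf.
rewrite normrZ normfV normr_id mulVf ?normr_eq0// => /(_ (lexx 1)).
by rewrite fZ normrZ normfV normr_id mulrC.
Qed.

Lemma continuous_contraction (R : realType) (V : normedModType R) (f : V -> R^o) :
  linear f -> (forall v, `|f v| <= `|v|) -> continuous f.
Proof.
move=> lf fle.
pose g : {linear V -> R^o} := HB.pack f (GRing.isLinear.Build R V R^o _ f lf).
apply: (@linear_bounded_continuous R V R^o g).1; apply/linear_boundedP.
near=> M => v; rewrite (le_trans (fle v))// ler_peMl//.
Unshelve. all: by end_near.
Qed.

(** Weak compactness of balls in ultrafilter form. All functionals can be tested along the same [U],
    since bounded reals always converge along it. *)
Lemma reflexive_ultra_limit (R : realType) (I : Type) (Y : normedModType R)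
    (U : set_system I) (C : R) (psi : I -> Y) :
  reflexive_space Y -> UltraFilter U -> (forall i, `|psi i| <= C) ->
  exists2 y, `|y| <= C & forall f, dual_space f -> f (psi i) @[i --> U] --> f y.
Proof.
move=> reflY UU psiC.
have dcvg (f : Y -> R^o) : dual_space f ->
    f (psi i) @[i --> U] --> (lim (f (psi i) @[i --> U]) : R^o).
  move=> [lf cf]; have [M M0 fM] := linear_norm_bound lf cf.
  have kM : compact `[- (M * C), M * C] by exact: segment_compact.
  have [|l _ fl] := @ultra_cvg_compact I R U _ (f \o psi) UU kM.
    move=> i /=; rewrite in_itv/= -ler_norml (le_trans (fM _))// ler_pM2l//.
  by apply/cvg_ex; exists l.
have [||y yF] := reflY (fun f => lim (f (psi i) @[i --> U])).
- move=> a f g df dg; apply: cvg_lim => //.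
  have FU : Filter U by exact _.
  have fl := @cvgZl_tmp R R^o I U FU a _ _ (dcvg f df).
  exact: (cvgD fl (dcvg g dg)).
- exists C => f df; apply: (cvgr_to_le (cvg_norm (dcvg f df))).
  near=> i; rewrite mulrC (le_trans (le_opnorm _ df.1 df.2))// ler_wpM2l//.
  exact: opnorm_ge0 df.1 df.2.
exists y => [|f df]; last by rewrite -(yF f df); exact: dcvg.
have [f [lf fy fle]] := norming_functional y.
have df : dual_space f by split=> //; exact: continuous_contraction.
rewrite -fy -(yF f df); apply: (cvgr_to_le (dcvg f df)).
by near=> i; rewrite (le_trans (ler_norm _))// (le_trans (fle _)).
Unshelve. all: by end_near.
Qed.

(** Compactness gives a strong limit in [X], reflexivity a weak limit in [Y]. They agree because a
    functional norming their difference, composed with [iota], lies in the dual of [Y]. *)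
Lemma compact_embedding_ultra_limit (R : realType) (I : Type)
    (X Y : normedModType R) (iota : {linear Y -> X})
    (U : set_system I) (C : R) (psi : I -> Y) :
  reflexive_space Y -> compact_embedding iota ->
  UltraFilter U -> (forall i, `|psi i| <= C) ->
  exists2 y, `|y| <= C & iota (psi i) @[i --> U] --> iota y.
Proof.
move=> reflY [_ ciota kiota] UU psiC.
have [y yC ylim] := reflexive_ultra_limit reflY UU psiC; exists y => //.
pose B := [set v : Y | `|v| <= C].
have /kiota : bounded_set B.
  by exists C; split; [exact: num_real | move=> M CM v Bv; exact: (le_trans Bv (ltW CM))].
rewrite precompactE => kB.
have clB i : closure (iota @` B) (iota (psi i)).
  by apply: subset_closure; exists (psi i) => //; exact: psiC.
have [x _ xlim] := ultra_cvg_compact UU kB clB.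
suff -> : iota y = x by [].
apply/eqP; rewrite -subr_eq0 -normr_eq0.
have [f [lf fy fle]] := norming_functional (iota y - x).
have cf := continuous_contraction lf fle.
have dfi : dual_space (f \o iota).
  split; first by move=> a u v /=; rewrite linearP; exact: lf.
  by move=> v; exact: (continuous_comp (ciota v) (cf _)).
have -> : `|iota y - x| = f (iota y) - f x.
  by rewrite -fy; have := lf (-1) x (iota y); rewrite !scaleN1r [in LHS]addrC => ->; rewrite addrC.
rewrite subr_eq0; apply/eqP.
apply: (cvg_unique _ (ylim _ dfi)) => //.
exact: (continuous_cvg _ (cf x) xlim).
Qed.

(** * Strong measurability *)

Import HBSimple.

Section StronglyMeasurable.
Context (R : realType) (D : set R).
Hypothesis mD : measurable (D : set (measurableTypeR R)).

Lemma simple_on_comp (V W : normedModType R) (g : V -> W) (s : R -> V) :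
  simple_on D s -> simple_on D (g \o s).
Proof.
move=> [fs ms]; split; first by rewrite -image_comp; exact: finite_image.
move=> w.
rewrite [X in measurable X](_ : _ =
    \bigcup_(v in s @` D `&` g @^-1` [set w]) (D `&` s @^-1` [set v])).
  by apply: fin_bigcup_measurable => [|v _]; [exact: finite_setIl | exact: ms].
apply/seteqP; split=> [t [Dt /= gw]|t [v [_ /= gw] [Dt sv]]].
  by exists (s t) => //; split=> //; exists t.
by split=> //=; rewrite sv.
Qed.

Lemma simple_on_pair (V W : normedModType R) (s1 : R -> V) (s2 : R -> W) :
  simple_on D s1 -> simple_on D s2 ->
  simple_on D (fun t => (s1 t, s2 t) : (V * W)%type).
Proof.
move=> [f1 m1] [f2 m2]; split.
  apply: (@sub_finite_set _ _ (s1 @` D `*` s2 @` D)); last exact: finite_setX.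
  by move=> _ [t Dt <-]; split; exists t.
move=> [v w].
rewrite [X in measurable X](_ : _ =
    (D `&` s1 @^-1` [set v]) `&` (D `&` s2 @^-1` [set w])); first exact: measurableI.
by apply/seteqP; split=> [t [Dt [<- <-]]|t [[Dt <-] [_ <-]]].
Qed.

(** Sums, scalar multiples, norms and coordinates below are all instances, after pairing where there
    are two arguments. *)
Lemma strongly_measurable_comp (V W : normedModType R) (g : V -> W) (f : R -> V) :
  continuous g -> strongly_measurable D f -> strongly_measurable D (g \o f).
Proof.
move=> cg [s [ss sf]]; exists (fun n => g \o s n); split=> [n|t Dt].
  exact: simple_on_comp.
by apply: (continuous_cvg _ (cg (f t))); exact: sf.
Qed.

Lemma strongly_measurable_pair (V W : normedModType R) (f : R -> V) (g : R -> W) :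
  strongly_measurable D f -> strongly_measurable D g ->
  strongly_measurable D (fun t => (f t, g t) : (V * W)%type).
Proof.
move=> [s [ss sf]] [s' [ss' sg]].
exists (fun n t => (s n t, s' n t)); split=> [n|t Dt]; first exact: simple_on_pair.
by apply: cvg_pair; [exact: sf | exact: sg].
Qed.

Lemma strongly_measurable_cst (V : normedModType R) (v : V) :
  strongly_measurable D (cst v).
Proof.
exists (fun=> cst v); split=> [_|t _]; last exact: cvg_cst.
split=> [|w]; first by apply: (sub_finite_set _ (finite_set1 v)) => _ [t _ <-].
by rewrite preimage_cst; case: ifP => _; rewrite ?setIT ?setI0.
Qed.

Lemma strongly_measurableD (V : normedModType R) (f g : R -> V) :
  strongly_measurable D f -> strongly_measurable D g ->
  strongly_measurable D (fun t => f t + g t).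
Proof.
move=> mf mg.
exact: (strongly_measurable_comp (@add_continuous V) (strongly_measurable_pair mf mg)).
Qed.

Lemma strongly_measurableZ (V : normedModType R) (a : R -> R) (f : R -> V) :
  strongly_measurable D a -> strongly_measurable D f ->
  strongly_measurable D (fun t => a t *: f t).
Proof.
move=> ma mf.
exact: (strongly_measurable_comp (V := (R^o * V)%type) (@scale_continuous R V)
  (strongly_measurable_pair (V := R^o) ma mf)).
Qed.

Lemma strongly_measurableB (V : normedModType R) (f g : R -> V) :
  strongly_measurable D f -> strongly_measurable D g ->
  strongly_measurable D (fun t => f t - g t).
Proof.
move=> mf mg; apply: strongly_measurableD => //.
have := strongly_measurableZ (strongly_measurable_cst (-1 : R)) mg.
by under eq_fun do rewrite /cst scaleN1r.
Qed.

Lemma strongly_measurable_sum (V : normedModType R) (I : Type) (r : seq I)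
    (f : I -> R -> V) :
  (forall i, strongly_measurable D (f i)) ->
  strongly_measurable D (fun t => \sum_(i <- r) f i t).
Proof.
move=> mf; elim: r => [|i r ih].
  by under eq_fun do rewrite big_nil; exact: strongly_measurable_cst.
by under eq_fun do rewrite big_cons; exact: strongly_measurableD.
Qed.

(** With its converse below, this lets real functions built by Borel measurability, such as upper
    limits, be used as elements of [L2]. *)
Lemma strongly_measurable_measurable (f : R -> R) :
  strongly_measurable D f -> measurable_fun D f.
Proof.
move=> [s [ss sf]]; apply: (measurable_fun_cvg (h := s)) => // n _ B mB.
have [fs ms] := ss n.
rewrite [X in measurable X](_ : _ =
    \bigcup_(v in s n @` D `&` B) (D `&` s n @^-1` [set v])).
  by apply: fin_bigcup_measurable => [|v _]; [exact: finite_setIl | exact: ms].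
apply/seteqP; split=> [t [Dt /= Bt]|t [v [_ /= Bv] [Dt sv]]].
  by exists (s n t) => //; split=> //; exists t.
by split=> //=; rewrite sv.
Qed.

Lemma measurable_strongly_measurable (f : R -> R) :
  measurable_fun D f -> strongly_measurable D f.
Proof.
move=> mf.
have [g gf] := approximation_sfun (mD : measurable (D : set (measurableTypeR R)))
  ((measurable_EFinP D f).2 mf).
exists (fun n => g n); split=> [n|t Dt]; last exact: (fine_cvg (gf t Dt)).
split; last by move=> v; exact: measurableI.
by apply: (sub_finite_set (B := range (g n))); [exact: image_subset | exact: fimfunP].
Qed.

Lemma strongly_measurable_norm (V : normedModType R) (f : R -> V) :
  strongly_measurable D f -> measurable_fun D (fun t => `|f t|).
Proof.
move=> mf; apply: strongly_measurable_measurable.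
exact: (strongly_measurable_comp (@norm_continuous _ V) mf).
Qed.

Lemma strongly_measurable_coord n (w : R -> 'rV[R]_n) i :
  strongly_measurable D w -> measurable_fun D (fun t => w t ord0 i).
Proof.
move=> mw; apply: strongly_measurable_measurable.
exact: (strongly_measurable_comp (@coord_continuous _ _ _ ord0 i) mw).
Qed.

End StronglyMeasurable.

(** * Square-integrable functions *)

Section L2Theory.
Context (R : realType) (T : R).
Local Notation mu := (@lebesgue_measure R).
Local Notation D := (`]0, T[%classic : set R).

(** An infinite integral is sent to the default value 0, so this is the squared norm only for [f] in
    [L2]. *)
Definition L2sq (V : normedModType R) (f : R -> V) : R :=
  \int[mu]_(t in D) (`|f t| ^+ 2).

Let mD : measurable (D : set (measurableTypeR R)).
Proof. exact: measurable_itv. Qed.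

Lemma measurable_normsq (V : normedModType R) (f : R -> V) :
  strongly_measurable D f -> measurable_fun D (fun t => (`|f t| ^+ 2)%:E).
Proof.
by move=> mf; apply/measurable_EFinP/measurable_funX; exact: strongly_measurable_norm.
Qed.

Lemma L2_integrable (V : normedModType R) (f : R -> V) :
  L2 T f -> mu.-integrable D (EFin \o (fun t => `|f t| ^+ 2)).
Proof.
move=> [mf fi]; apply/integrableP; split; first exact: measurable_normsq.
by under eq_integral => t _ do rewrite /= ger0_norm ?sqr_ge0//.
Qed.

Let L2_integrableZ (V : normedModType R) (c : R) (f : R -> V) :
  L2 T f -> mu.-integrable D (EFin \o (fun t => c * `|f t| ^+ 2)).
Proof. by move=> f2; exact: (integrableZl mD c (L2_integrable f2)). Qed.

Lemma L2sqE (V : normedModType R) (f : R -> V) : L2 T f ->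
  (L2sq f)%:E = (\int[mu]_(t in D) (`|f t| ^+ 2)%:E)%E.
Proof.
move=> f2; rewrite /L2sq /Rintegral fineK//.
by apply: integrable_fin_num => //; exact: L2_integrable.
Qed.

Lemma L2sq_ge0 (V : normedModType R) (f : R -> V) : 0 <= L2sq f.
Proof. by apply: Rintegral_ge0 => t _; exact: sqr_ge0. Qed.

Section Comb.
Context (U V W : normedModType R) (h : R -> U) (f : R -> V) (g : R -> W) (a b : R).
Hypothesis hfg : forall t, D t -> `|h t| ^+ 2 <= a * `|f t| ^+ 2 + b * `|g t| ^+ 2.
Hypotheses (f2 : L2 T f) (g2 : L2 T g).

Let comb_integrable :
  mu.-integrable D (EFin \o (fun t => a * `|f t| ^+ 2 + b * `|g t| ^+ 2)).
Proof.
exact: (integrableD mD (L2_integrableZ a f2) (L2_integrableZ b g2)).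
Qed.

(** One pointwise domination serves for sums, multiples, coordinates and the norm estimates. The
    three value spaces may differ, so that scalar coefficients can dominate [X]-valued products. *)
Lemma L2_comb : strongly_measurable D h -> L2 T h.
Proof.
move=> mh; split=> //.
apply: (le_lt_trans _ (integrable_lty mD comb_integrable)).
apply: ge0_le_integral => //.
  exact: measurable_normsq.
exact: measurable_int comb_integrable.
Qed.

Lemma L2sq_comb : L2 T h -> L2sq h <= a * L2sq f + b * L2sq g.
Proof.
move=> h2.
have -> : a * L2sq f + b * L2sq g =
    \int[mu]_(t in D) (a * `|f t| ^+ 2 + b * `|g t| ^+ 2).
  rewrite RintegralD ?RintegralZl//; try exact: L2_integrable.
  - exact: L2_integrableZ.
  - exact: L2_integrableZ.
by apply: le_Rintegral => //; exact: L2_integrable.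
Qed.

End Comb.

Lemma normD_sqr (V : normedModType R) (x y : V) :
  `|x + y| ^+ 2 <= 2 * `|x| ^+ 2 + 2 * `|y| ^+ 2.
Proof.
apply: (@le_trans _ _ ((`|x| + `|y|) ^+ 2)).
  by rewrite lerXn2r ?nnegrE ?addr_ge0// ler_normD.
by have := sqr_ge0 (`|x| - `|y|); rewrite !expr2; lra.
Qed.

Lemma L2D (V : normedModType R) (f g : R -> V) :
  L2 T f -> L2 T g -> L2 T (fun t => f t + g t).
Proof.
move=> f2 g2; apply: (L2_comb (a := 2) (b := 2) _ f2 g2) => [t _|].
  exact: normD_sqr.
by apply: strongly_measurableD; [exact: f2.1 | exact: g2.1].
Qed.

Lemma L2_0 (V : normedModType R) : L2 T (cst (0 : V)).
Proof.
split; first exact: strongly_measurable_cst.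
under eq_integral do rewrite /cst normr0 expr0n/=.
by rewrite integral0 ltry.
Qed.

Lemma L2_scale (V : normedModType R) (a : R -> R) (g : R -> V) (M : R) :
  L2 T a -> strongly_measurable D g -> (forall t, `|g t| <= M) ->
  L2 T (fun t => a t *: g t).
Proof.
move=> a2 mg gM; apply: (L2_comb (a := M ^+ 2) (b := 0) _ a2 a2) => [t _|].
  rewrite mul0r addr0 normrZ exprMn mulrC ler_wpM2r ?sqr_ge0//.
  by rewrite lerXn2r ?nnegrE// (le_trans _ (gM t)).
by apply: strongly_measurableZ => //; exact: a2.1.
Qed.

Lemma L2Z (V : normedModType R) (c : R) (f : R -> V) :
  L2 T f -> L2 T (fun t => c *: f t).
Proof.
move=> f2; apply: (L2_comb (a := `|c| ^+ 2) (b := 0) _ f2 f2) => [t _|].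
  by rewrite mul0r addr0 normrZ exprMn.
apply: strongly_measurableZ; last exact: f2.1.
exact: strongly_measurable_cst.
Qed.

Lemma L2B (V : normedModType R) (f g : R -> V) :
  L2 T f -> L2 T g -> L2 T (fun t => f t - g t).
Proof.
move=> f2 g2; apply: L2D => //.
by have := L2Z (-1) g2; under eq_fun do rewrite scaleN1r.
Qed.

Lemma L2_sum (V : normedModType R) (I : Type) (r : seq I) (f : I -> R -> V) :
  (forall i, L2 T (f i)) -> L2 T (fun t => \sum_(i <- r) f i t).
Proof.
move=> f2; elim: r => [|i r ih].
  by under eq_fun do rewrite big_nil; exact: L2_0.
by under eq_fun do rewrite big_cons; exact: L2D.
Qed.

Lemma coord_le_norm n (w : 'rV[R]_n) i : `|w ord0 i| <= `|w|.
Proof.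
rewrite {2}/Num.Def.normr/= mx_normrE.
exact: (le_bigmax _ (fun ij => `|w ij.1 ij.2|) (ord0, i)).
Qed.

Lemma L2_coord n (w : R -> 'rV[R]_n) i : L2 T w -> L2 T (fun t => w t ord0 i).
Proof.
move=> w2; apply: (L2_comb (a := 1) (b := 0) _ w2 w2) => [t _|].
  by rewrite mul1r mul0r addr0 lerXn2r ?nnegrE// coord_le_norm.
apply: measurable_strongly_measurable => //.
by apply: strongly_measurable_coord => //; exact: w2.1.
Qed.

Lemma L2_row n (w : R -> 'rV[R]_n) :
  (forall i, L2 T (fun t => w t ord0 i)) -> L2 T w.
Proof.
move=> w2; have -> : w = fun t => \sum_(i < n) w t ord0 i *: delta_mx ord0 i.
  by apply/funext => t; rewrite -row_sum_delta.
apply: L2_sum => i; apply: (L2_scale (M := `|delta_mx ord0 i : 'rV[R]_n|)) => //.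
exact: strongly_measurable_cst.
Qed.

Lemma L2sq_midpoint (V : normedModType R) (f g : R -> V) :
  L2 T f -> L2 T g ->
  L2sq (fun t => 2^-1 *: (f t + g t)) <= 2^-1 * (L2sq f + L2sq g).
Proof.
move=> f2 g2; rewrite mulrDr; apply: L2sq_comb => //; last exact/L2Z/L2D.
move=> t _; rewrite normrZ exprMn ger0_norm//.
by have := normD_sqr (f t) (g t); lra.
Qed.

(** Stated for real functions and used coordinatewise, as the maximum norm on rows does not obey the
    parallelogram identity. *)
Lemma L2sq_parallelogram (f g : R -> R) : L2 T f -> L2 T g ->
  L2sq (fun t => 2^-1 * (f t - g t)) + L2sq (fun t => 2^-1 * (f t + g t)) =
  2^-1 * (L2sq f + L2sq g).
Proof.
move=> f2 g2.
have s2 : L2 T (fun t => 2^-1 * (f t - g t)) by exact: (@L2Z R^o _ _ (@L2B R^o _ _ f2 g2)).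
have d2 : L2 T (fun t => 2^-1 * (f t + g t)) by exact: (@L2Z R^o _ _ (@L2D R^o _ _ f2 g2)).
rewrite /L2sq -!RintegralD//; try exact: L2_integrable.
rewrite -RintegralZl//; last exact: (integrableD mD (L2_integrable f2) (L2_integrable g2)).
apply: eq_Rintegral => t _; rewrite !real_normK ?num_real//; by field.
Qed.

(** The triangle inequality followed by [2xy <= d x^2 + y^2 / d]. It replaces the Lipschitz bound
    for the square root of [J]; the factor [1 + d] is later sent to 1. *)
Lemma L2sq_young (V : normedModType R) (d : R) (f g : R -> V) :
  0 < d -> L2 T f -> L2 T g ->
  L2sq f <= (1 + d) * L2sq g + (1 + d^-1) * L2sq (fun t => f t - g t).
Proof.
move=> d0 f2 g2; apply: L2sq_comb => //; last exact: L2B.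
move=> t _; set x := `|g t|; set y := `|f t - g t|.
apply: (@le_trans _ _ ((x + y) ^+ 2)).
  have fxy : `|f t| <= x + y by rewrite -[f t](subrK (g t)) addrC ler_normD.
  by apply: lerXn2r fxy; rewrite nnegrE// addr_ge0// normr_ge0.
have : 0 <= d^-1 * (d * x - y) ^+ 2 by rewrite mulr_ge0 ?sqr_ge0// invr_ge0 ltW.
suff -> : d^-1 * (d * x - y) ^+ 2 = d * x ^+ 2 - 2 * x * y + d^-1 * y ^+ 2.
  by rewrite !expr2; lra.
by field; rewrite gt_eqF.
Qed.

End L2Theory.

(** * Minimal selections and limits in L^2 *)

(* Points of S that are nearly N-minimal among the nearly Q-minimal ones: by the
   parallelogram identity they are Cauchy for N, without any strict convexity of Q. *)
Lemma midpoint_selection (R : realType) (H : lmodType R) (S : set H)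
    (N Q : H -> R) (B : R) :
  S !=set0 ->
  (forall a b, S a -> S b -> S (2^-1 *: (a + b))) ->
  (forall a, S a -> 0 <= N a <= B) ->
  (forall a, S a -> 0 <= Q a) ->
  (forall a b, S a -> S b -> Q (2^-1 *: (a + b)) <= 2^-1 * (Q a + Q b)) ->
  (forall a b, S a -> S b ->
     N (2^-1 *: (a - b)) + N (2^-1 *: (a + b)) = 2^-1 * (N a + N b)) ->
  exists w : nat -> H, forall k,
    [/\ S (w k), Q (w k) <= inf (Q @` S) + 4^-1 ^+ k &
        N (2^-1 *: (w k - w k.+1)) <= 2 * 4^-1 ^+ k].
Proof.
move=> [s0 Ss0] Smid NB Q0 Qmid Npar.
have infQ : has_inf (Q @` S).
  by split; [exists (Q s0), s0 | exists 0 => _ [a Sa <-]; exact: Q0].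
pose m := inf (Q @` S).
pose L e := [set a | S a /\ Q a <= m + e].
have L0 e : 0 < e -> L e !=set0.
  by move=> e0; have [_ [a Sa <-] /ltW ae] := inf_adherent e0 infQ; exists a.
have infN e : 0 < e -> has_inf (N @` L e).
  move=> e0; split; first by have [a La] := L0 _ e0; exists (N a), a.
  by exists 0 => _ [a [Sa _] <-]; have /andP[] := NB _ Sa.
(* The infimum of [N] over [L e] grows as [e] decreases, so [sup E] is its limit as [e] tends to
   0. *)
pose E := [set inf (N @` L e) | e in [set e | 0 < e]].
have supE : has_sup E.
  split; first by exists (inf (N @` L 1)), 1 => //=.
  exists B => _ [e /= e0 <-]; have [a La] := L0 _ e0.
  have /andP[_ NaB] := NB _ La.1; apply: le_trans NaB.
  by apply: ge_inf; [exact: (infN _ e0).2 | exists a].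
(* The level [e] is kept with the point: on all of [L e], [N] is at least [sup E - d], and this must
   also apply to midpoints. *)
have near_min d : 0 < d -> exists we : H * R,
    [/\ S we.1, we.2 <= d, Q we.1 <= m + we.2, N we.1 <= sup E + d &
        forall v, S v -> Q v <= m + we.2 -> sup E - d <= N v].
  move=> d0; have [_ [e0 /= e00 <-] e0E] := sup_adherent d0 supE.
  pose e := Num.min e0 d; have e_gt0 : 0 < e by rewrite lt_min e00.
  have [_ [w [Sw Qw] <-] Nw] := inf_adherent d0 (infN _ e_gt0).
  exists (w, e); split => //=; first by rewrite ge_min lexx orbT.
    apply: (le_trans (ltW Nw)); rewrite lerD2r; apply: ub_le_sup; first exact: supE.2.
    by exists e.
  move=> v Sv Qv; apply: (le_trans (ltW e0E)); apply: ge_inf; first exact: (infN _ e00).2.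
  by exists v => //; split=> //; rewrite (le_trans Qv)// lerD2l ge_min lexx.
have d_gt0 k : 0 < 4^-1 ^+ k :> R by rewrite exprn_gt0.
have [we weP] := choice (fun k => near_min _ (d_gt0 k)).
exists (fst \o we) => k /=; have [Sw ek Qw Nw Nlow] := weP k.
have [Sw' ek' Qw' Nw' Nlow'] := weP k.+1.
have dS : 4^-1 ^+ k.+1 <= 4^-1 ^+ k :> R.
  by rewrite exprS ger_pMl// invf_le1// ler1n.
split=> //; first by rewrite (le_trans Qw)// lerD2l.
set a := (we k).1 in Sw Qw Nw *; set b := (we k.+1).1 in Sw' Qw' Nw' *.
have Nmid : sup E - 4^-1 ^+ k <= N (2^-1 *: (a + b)).
  have Qab := Qmid _ _ Sw Sw'.
  (* The chosen levels need not decrease in [k]; the midpoint lies in the larger of the two. *)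
  have [ee|/ltW ee] := leP (we k.+1).2 (we k).2.
    by apply: Nlow; [exact: Smid | lra].
  apply: (@le_trans _ _ (sup E - 4^-1 ^+ k.+1)); first lra.
  by apply: Nlow'; [exact: Smid | lra].
by have := Npar _ _ Sw Sw'; lra.
Qed.

Section L2Limits.
Context (R : realType) (T : R).
Local Notation mu := (@lebesgue_measure R).
Local Notation D := (`]0, T[%classic : set R).

Let mD : measurable (D : set (measurableTypeR R)).
Proof. exact: measurable_itv. Qed.

(** Since [x <= 2^k x^2 + 2^-k] and the interval has finite measure [K], the increments have
    integrals at most [(c + K) 2^-k]. Their sum is integrable, hence finite a.e., and the
    telescoping series converges absolutely there. *)
Lemma L2sq_ae_cvg (v : nat -> R -> R) (c : R) :
  (forall k, L2 T (v k)) ->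
  (forall k, L2sq T (fun t => v k t - v k.+1 t) <= c * 4^-1 ^+ k) ->
  exists2 u : R -> R, measurable_fun D u &
    {ae mu, forall t, D t -> v k t @[k --> \oo] --> u t}.
Proof.
move=> v2 vc.
have mv k : measurable_fun D (v k) := strongly_measurable_measurable (v2 k).1.
pose d k t := `|v k t - v k.+1 t|.
have mug : (mu D < +oo)%E by rewrite lebesgue_measure_itv/=; case: ifP => _; rewrite ltry.
pose K := fine (mu D).
have muK : mu D = K%:E by rewrite fineK// ge0_fin_numE.
have md k : measurable_fun D (EFin \o d k).
  apply/measurable_EFinP; apply: measurableT_comp => //; exact: measurable_funB.
have dint k : (\int[mu]_(t in D) (d k t)%:E <=
    (2 * (c + K) / (2 ^ (k + 1))%:R)%:E)%E.
  have dv2 : L2 T (fun t => v k t - v k.+1 t) := @L2B R T R^o _ _ (v2 k) (v2 k.+1).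
  have k0 : 0 < 2 ^+ k :> R by rewrite exprn_gt0.
  have m2 : measurable_fun D (fun t => (2 ^+ k)%:E * (`|v k t - v k.+1 t| ^+ 2)%:E)%E.
    exact: (measurable_funeM (2 ^+ k)%:E (measurable_normsq dv2.1)).
  apply: (@le_trans _ _ (\int[mu]_(t in D)
      ((2 ^+ k)%:E * (`|v k t - v k.+1 t| ^+ 2)%:E + (2 ^- k)%:E))%E).
    apply: ge0_le_integral => //.
    - by move=> t _; rewrite lee_fin normr_ge0.
    - exact: md.
    - exact: (emeasurable_funD m2 (measurable_cst _)).
    - move=> t _; rewrite -EFinM -EFinD lee_fin /d; set x := `|_|.
      have : 0 <= 2 ^- k * (2 ^+ k * x - 2^-1) ^+ 2.
        by rewrite mulr_ge0 ?sqr_ge0// invr_ge0 ltW.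
      suff -> : 2 ^- k * (2 ^+ k * x - 2^-1) ^+ 2 = 2 ^+ k * x ^+ 2 - x + 4^-1 * 2 ^- k.
        have : 0 <= 2 ^- k :> R by rewrite invr_ge0 ltW.
        by lra.
      by field; rewrite gt_eqF.
  rewrite ge0_integralD// ge0_integralZl//; last exact: measurable_normsq dv2.1.
  rewrite integral_cst// [X in (_ * _ + _ * X)%E](_ : _ = K%:E)// -L2sqE// -!EFinM -EFinD lee_fin.
  rewrite addn1 expnS natrM natrX.
  have -> : 2 * (c + K) / (2 * 2 ^+ k) = 2 ^+ k * (c * (2 ^- k * 2 ^- k)) + 2 ^- k * K.
    by field; rewrite gt_eqF.
  rewrite lerD2r ler_wpM2l//.
  rewrite (le_trans (vc k))// (_ : 4 = 2 * 2); last by rewrite -natrM.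
  by rewrite exprVn exprMn invfM.
pose S t := (\sum_(0 <= k <oo) (d k t)%:E)%E.
have Sint : mu.-integrable D S.
  have S0 t : (0 <= S t)%E by apply: nneseries_ge0 => k _ _; rewrite lee_fin normr_ge0.
  apply/integrableP; split.
    apply: ge0_emeasurable_sum => [k t _ _|k _]; [by rewrite lee_fin normr_ge0 | exact: md].
  under eq_integral do rewrite gee0_abs//.
  rewrite integral_nneseries//; last by move=> k t _; rewrite lee_fin normr_ge0.
  apply: (@le_lt_trans _ _ (\sum_(0 <= k <oo) (2 * (c + K) / (2 ^ (k + 1))%:R)%:E)%E).
    by apply: lee_nneseries => // k _ _; apply: integral_ge0 => t _; rewrite lee_fin normr_ge0.
  by rewrite (cvg_lim _ (@cvg_geometric_eseries_half R (2 * (c + K)) 0))// ltry.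
(* The upper limit is measurable and defined at every [t]; it is the limit wherever the sequence
   converges. *)
pose u t := fine (limn_esup (fun n => (v n t)%:E)).
exists u.
  apply: measurableT_comp => //; apply: measurable_fun_limn_esup => n.
  exact/measurable_EFinP.
have := integrable_ae mD Sint; apply: filterS => t St Dt.
have vt : cvgn (fun n => v n t).
  have Sfin : (S t < +oo)%E by have := St Dt; rewrite fin_numE => /andP[_]; rewrite ltey.
  have := nnseries_is_cvg (fun k => normr_ge0 _) Sfin.
  have -> : series (d^~ t) = [normed series (telescope (v^~ t))].
    by apply/funext => n; apply: eq_bigr => k _; rewrite /d distrC.
  move=> /normed_cvg; rewrite telescopeK => vcvg.
  rewrite (_ : (fun n => v n t) = (fun n => v n t - v 0%N t) + cst (v 0%N t)).
    by apply: is_cvgD => //; exact: is_cvg_cst.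
  by apply/funext => n; rewrite !fctE subrK.
have vE : (v n t)%:E @[n --> \oo] --> (limn (fun n => v n t))%:E.
  by apply: cvg_EFin => //; exact: nearW.
by rewrite /u (cvg_limn_einf_sup vE).2.
Qed.

(** Lower semicontinuity under a.e. convergence. It serves both to keep the coefficients in the ball
    and to pass to the limit in the cost. *)
Lemma L2sq_fatou (V : normedModType R) (f : nat -> R -> V) (g : R -> V)
    (b : nat -> R) (B : R) :
  (forall k, L2 T (f k)) -> strongly_measurable D g ->
  {ae mu, forall t, D t -> f k t @[k --> \oo] --> g t} ->
  (forall k, L2sq T (f k) <= b k) -> b k @[k --> \oo] --> B ->
  L2 T g /\ L2sq T g <= B.
Proof.
move=> f2 mg fg fb bB.
have gB : (\int[mu]_(t in D) (`|g t| ^+ 2)%:E <= B%:E)%E.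
  apply: (@le_trans _ _ (\int[mu]_(t in D) limn_einf (fun k => (`|f k t| ^+ 2)%:E))%E).
    apply: ae_ge0_le_integral => //.
    - exact: measurable_normsq.
    - move=> t _; rewrite limn_einf_lim; apply: lime_ge; first exact: is_cvg_einfs.
      by apply: nearW => n; apply: le_ereal_inf_tmp => _ [k _ <-]; rewrite lee_fin sqr_ge0.
    - apply: measurableT_comp => //; apply: measurable_fun_limn_esup => n.
      by apply: measurableT_comp => //; exact: measurable_normsq (f2 n).1.
    - apply: (@filterS _ _ (ae_filter_ringOfSetsType mu)) fg => t fgt Dt.
      have nfg : (`|f k t| ^+ 2)%:E @[k --> \oo] --> (`|g t| ^+ 2)%:E.
        apply: cvg_EFin; first exact: nearW.
        exact: (continuous_cvg _ (@exprn_continuous R 2 _) (cvg_norm (fgt Dt))).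
      by rewrite (cvg_limn_einf_sup nfg).1.
  apply: le_trans; first apply: fatou => //.
    by move=> n; exact: measurable_normsq (f2 n).1.
  rewrite limn_einf_lim.
  have bBE : (b n)%:E @[n --> \oo] --> B%:E by apply: cvg_EFin => //; exact: nearW.
  rewrite -(cvg_lim _ bBE)//; apply: lee_lim.
  - exact: is_cvg_einfs.
  - by apply/cvg_ex; exists B%:E.
  apply: nearW => n; apply: (@le_trans _ _ (\int[mu]_(t in D) (`|f n t| ^+ 2)%:E)%E).
    by apply: ereal_inf_lbound; exists n => /=.
  by rewrite -L2sqE// lee_fin.
have g2 : L2 T g by split=> //; exact: le_lt_trans gB (ltry _).
by split=> //; rewrite -lee_fin L2sqE.
Qed.

End L2Limits.

(** * Minimization over the coefficients *)

Lemma L2sq0 (R : realType) (T : R) (V : normedModType R) : L2sq T (cst (0 : V)) = 0.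
Proof.
rewrite /L2sq /Rintegral.
by under eq_integral do rewrite /cst normr0 expr0n/=; rewrite integral0.
Qed.

Section FixedModes.
Context (R : realType) (T : R) (X : normedModType R) (r : nat).
Local Notation mu := (@lebesgue_measure R).
Local Notation D := (`]0, T[%classic : set R).

(** The constraint of [admissible] on the coefficients alone. It does not involve the modes, so one
    may minimize over it with the modes fixed. *)
Definition L2ball (C : R) : set (R -> 'rV[R]_r) :=
  [set w : R -> 'rV[R]_r | L2 T w /\ forall i, L2sq T (fun t => w t ord0 i) <= C ^+ 2].

Definition residual (z : R -> X) (g : 'I_r -> R -> X) (w : R -> 'rV[R]_r) (t : R) : X :=
  z t - \sum_(i < r) w t ord0 i *: g i t.

Context (z : R -> X) (g : 'I_r -> R -> X) (M C : R).
Hypotheses (z2 : L2 T z) (mg : forall i, strongly_measurable D (g i)).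
Hypotheses (gM : forall i t, `|g i t| <= M).

Lemma L2_residual (w : R -> 'rV[R]_r) : L2 T w -> L2 T (residual z g w).
Proof.
move=> w2; apply: L2B => //; apply: L2_sum => i.
by apply: (L2_scale (M := M)) => //; exact: L2_coord.
Qed.

Lemma L2ball_midpoint a b : L2ball C a -> L2ball C b -> L2ball C (2^-1 *: (a + b)).
Proof.
move=> [a2 aC] [b2 bC]; split; first exact: L2Z (L2D a2 b2).
move=> i; rewrite (_ : (fun t => _) = fun t => 2^-1 *: ((a t ord0 i : R^o) + b t ord0 i)).
  apply: (le_trans (@L2sq_midpoint R T R^o _ _ (L2_coord i a2) (L2_coord i b2))).
  by have := aC i; have := bC i; rewrite /L2sq/=; lra.
by apply/funext => t; rewrite !fctE !mxE.
Qed.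

Lemma exists_L2ball_minimizer :
  exists2 w, L2ball C w &
    forall w', L2ball C w' -> L2sq T (residual z g w) <= L2sq T (residual z g w').
Proof.
(* The sum over coordinates is the squared Hilbert norm, for which the parallelogram identity
   holds. *)
pose N (w : R -> 'rV[R]_r) := \sum_(i < r) L2sq T (fun t => w t ord0 i).
pose Q w := L2sq T (residual z g w).
have [||a aS|a _|a b [a2 _] [b2 _]|a b [a2 _] [b2 _]|w wP] :=
    @midpoint_selection R (R -> 'rV[R]_r) (L2ball C) N Q (\sum_(i < r) C ^+ 2).
- exists (cst 0); split; first exact: L2_0.
  move=> i; rewrite (_ : (fun t => _) = cst 0); last by apply/funext => t; rewrite mxE.
  by rewrite (@L2sq0 R T R^o) sqr_ge0.
- exact: L2ball_midpoint.
- rewrite sumr_ge0/=; last by move=> i _; exact: L2sq_ge0.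
  by apply: ler_sum => i _; exact: aS.2.
- exact: L2sq_ge0.
- rewrite /Q (_ : residual z g _ = fun t => 2^-1 *: (residual z g a t + residual z g b t)).
    by apply: L2sq_midpoint; exact: L2_residual.
  apply/funext => t; rewrite /residual addrACA -opprD -big_split/= scalerBr.
  congr (_ - _).
    rewrite scalerDr -scalerDl -mulr2n -[_ *+ 2]mulr_natr mulVf ?pnatr_eq0//.
    by rewrite scale1r.
  by rewrite scaler_sumr; apply: eq_bigr => i _; rewrite !fctE !mxE -scalerDl scalerA.
- rewrite /N -!big_split/= mulr_sumr; apply: eq_bigr => i _.
  rewrite -L2sq_parallelogram; [|exact: L2_coord|exact: L2_coord].
  by congr (_ + _); congr (L2sq T _); apply/funext => t; rewrite !fctE !mxE.
have w2 k : L2 T (w k) by have [[]] := wP k.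
pose v i k t := w k t ord0 i.
have v2 i k : L2 T (v i k) by exact: L2_coord.
(* In [8 = 4 * 2], the 4 undoes the squared factor [2^-1] and the 2 comes from
   [midpoint_selection]. *)
have vB i k : L2sq T (fun t => v i k t - v i k.+1 t) <= 8 * 4^-1 ^+ k.
  have d2 := @L2B R T R^o _ _ (v2 i k) (v2 i k.+1).
  have h2 := @L2Z R T R^o 2^-1 _ d2.
  have := @L2sq_comb R T R^o R^o R^o _ _ _ 4 0 _ h2 h2 d2.
  rewrite mul0r addr0 => /(_ _)/le_trans; apply.
    move=> t _; rewrite mul0r addr0 normrZ exprMn ger0_norm//; lra.
  have [_ _ Nk] := wP k; rewrite (_ : 8 = 4 * 2); last by rewrite -natrM.
  rewrite -mulrA ler_pM2l//; apply: le_trans Nk; rewrite /N (bigD1 i)//=.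
  rewrite (_ : L2sq T _ = L2sq T (fun t => (2^-1 *: (w k - w k.+1)) t ord0 i)).
    by rewrite lerDl sumr_ge0// => j _; exact: L2sq_ge0.
  by congr (L2sq T _); apply/funext => t; rewrite !fctE !mxE.
have uex i : exists u : R -> R, measurable_fun D u /\
    {ae mu, forall t, D t -> v i k t @[k --> \oo] --> u t}.
  by have [u mu_ uc] := L2sq_ae_cvg (v2 i) (vB i); exists u.
have [u uP] := choice uex.
have u2 i : L2 T (u i : R -> R^o) /\ L2sq T (u i : R -> R^o) <= C ^+ 2.
  apply: (@L2sq_fatou R T R^o (v i) (u i) (cst (C ^+ 2))) => //.
  - by apply: measurable_strongly_measurable => //; exact: (uP i).1.
  - exact: (uP i).2.
  - by move=> k; have [[_ wC] _ _] := wP k; exact: wC.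
  - exact: cvg_cst.
pose w0 t : 'rV[R]_r := \row_i u i t.
have w0E i : (fun t => w0 t ord0 i) = u i by apply/funext => t; rewrite mxE.
have w02 : L2 T w0 by apply: L2_row => i; rewrite w0E; exact: (u2 i).1.
exists w0; first by split=> // i; rewrite w0E; exact: (u2 i).2.
move=> w' w'S; apply: (@le_trans _ _ (inf (Q @` L2ball C))); last first.
  apply: ge_inf; last by exists w'.
  by exists 0 => _ [a _ <-]; exact: L2sq_ge0.
have [] // := @L2sq_fatou R T X (fun k => residual z g (w k)) (residual z g w0)
  (fun k => inf (Q @` L2ball C) + 4^-1 ^+ k) (inf (Q @` L2ball C)).
- by move=> k; exact: L2_residual.
- exact: (L2_residual w02).1.
- have : \forall t \ae mu, forall i, D t -> v i k t @[k --> \oo] --> u i t.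
    by apply: filter_forall => i; exact: (uP i).2.
  apply: (@filterS _ _ (ae_filter_ringOfSetsType mu)) => t vu Dt.
  apply: cvgB; first exact: cvg_cst.
  apply: cvg_big => [|i _]; first exact: add_continuous.
  by apply: cvgZr_tmp; rewrite mxE; exact: vu.
- by move=> k; have [] := wP k.
- rewrite -[X in _ --> X]addr0; apply: cvgD; first exact: cvg_cst.
  by apply: cvg_expr; rewrite ger0_norm// invf_lt1// ltr1n.
Qed.

End FixedModes.

(** * Dependence of the residual on the modes *)

Lemma L2sq_sum_le (R : realType) (T : R) (V : normedModType R) (I : Type)
    (s : seq I) (f : I -> R -> V) :
  (forall i, L2 T (f i)) ->
  L2sq T (fun t => \sum_(i <- s) f i t) <= 2 ^+ size s * \sum_(i <- s) L2sq T (f i).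
Proof.
move=> f2; elim: s => [|i s ih].
  rewrite big_nil mulr0 (_ : (fun t => _) = cst 0) ?L2sq0//.
  by apply/funext => t; rewrite big_nil.
rewrite (_ : (fun t => _) = fun t => f i t + \sum_(j <- s) f j t); last first.
  by apply/funext => t; rewrite big_cons.
have s2 : L2 T (fun t => \sum_(j <- s) f j t) by exact: L2_sum.
(* Each splitting costs a factor 2. The resulting constant is crude but will only multiply
   quantities tending to 0. *)
apply: (le_trans (L2sq_comb (fun t _ => normD_sqr _ _) (f2 i) s2 (L2D (f2 i) s2))).
rewrite big_cons /= mulrDr exprS lerD//; last by rewrite -mulrA ler_pM2l.
by rewrite ler_wpM2r ?L2sq_ge0// ler_peMr// exprn_ege1// ler1n.
Qed.

(** The two residuals differ by the sum of [w_i (g'_i - g_i)]. As [e i] bounds the second factor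
    uniformly in [t], the error depends on [w] only through [C]. *)
Lemma L2sq_residual_perturb (R : realType) (T : R) (X : normedModType R) (r : nat)
    (z : R -> X) (g g' : 'I_r -> R -> X) (w : R -> 'rV[R]_r)
    (C M d : R) (e : 'I_r -> R) :
  L2 T z -> L2ball T C w ->
  (forall i, strongly_measurable `]0, T[ (g i)) -> (forall i t, `|g i t| <= M) ->
  (forall i, strongly_measurable `]0, T[ (g' i)) -> (forall i t, `|g' i t| <= M) ->
  (forall i t, `|g' i t - g i t| <= e i) -> 0 < d ->
  L2sq T (residual z g w) <=
  (1 + d) * L2sq T (residual z g' w) +
  (1 + d^-1) * (2 ^+ r * \sum_(i < r) e i ^+ 2 * C ^+ 2).
Proof.
move=> z2 [w2 wC] mg gM mg' gM' gg'e d0.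
have res2 := L2_residual z2 mg gM w2; have res2' := L2_residual z2 mg' gM' w2.
apply: (le_trans (L2sq_young d0 res2 res2')); rewrite lerD2l.
rewrite ler_wpM2l ?addr_ge0 ?invr_ge0 ?(ltW d0)//.
rewrite (_ : (fun t => _) =
    fun t => \sum_(i < r) w t ord0 i *: (g' i t - g i t)); last first.
  apply/funext => t; rewrite /residual opprB addrC addrA subrK -sumrB.
  by apply: eq_bigr => i _; rewrite scalerBr.
have md i : strongly_measurable `]0, T[ (fun t => g' i t - g i t).
  exact: strongly_measurableB.
have f2 i : L2 T (fun t => w t ord0 i *: (g' i t - g i t)).
  by apply: (L2_scale (M := e i)) => //; exact: L2_coord.
have := L2sq_sum_le (index_enum 'I_r) f2; rewrite /index_enum -enumT size_enum_ord => le1.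
apply: (le_trans le1); rewrite ler_pM2l ?exprn_gt0// enumT ler_sum// => i _.
apply: (@le_trans _ _ (e i ^+ 2 * L2sq T (fun t => w t ord0 i) + 0)).
  rewrite -(mul0r (L2sq T (fun t => w t ord0 i))).
  apply: (@L2sq_comb R T X R R) => //; [|exact: L2_coord|exact: L2_coord].
  move=> t _; rewrite mul0r addr0 normrZ exprMn mulrC ler_wpM2r ?sqr_ge0//.
  by rewrite lerXn2r ?nnegrE// (le_trans _ (gg'e i t)).
by rewrite addr0 ler_wpM2l ?sqr_ge0.
Qed.

Lemma le_of_le_1DM (R : realType) (x m : R) :
  0 <= m -> (forall d, 0 < d -> x <= (1 + d) * m) -> x <= m.
Proof.
move=> m0 h; apply/ler_addgt0Pr => e e0.
(* Dividing by [m + 1] covers the case [m = 0]. *)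
have m1 : 0 < m + 1 by rewrite ltr_pwDr.
apply: (le_trans (h (e / (m + 1)) (divr_gt0 e0 m1))).
rewrite mulrDl mul1r lerD2l mulrAC ler_pdivrMr// ler_pM2l//.
by rewrite lerDl.
Qed.

(** * Existence of a minimizer *)

(** By invariance the path factors through [Y], where dependence on the parameter is continuous;
    strong measurability of [p] then carries over. *)
Lemma strongly_measurable_transport (R : realType) (T : R) (X Y : normedModType R)
    (iota : Y -> X) (q : nat) (p : R -> 'rV[R]_q) (A : 'rV[R]_q -> {linear X -> X})
    (y : Y) :
  continuous iota ->
  (forall eta y, exists y', A eta (iota y) = iota y') ->
  (forall y (g : 'rV[R]_q -> Y), (forall eta, A eta (iota y) = iota (g eta)) -> continuous g) ->
  L2 T p -> strongly_measurable `]0, T[ (fun t => A (p t) (iota y)).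
Proof.
move=> ciota Ainv Acont [mp _].
have [g gP] := choice (fun eta => Ainv eta y).
rewrite (_ : (fun t => _) = (iota \o g) \o p); last by apply/funext => t /=; rewrite -gP.
apply: strongly_measurable_comp mp => eta.
by apply: continuous_comp; [exact: Acont gP eta | exact: ciota].
Qed.

Lemma JE (R : realType) (X : normedModType R) (r : nat) (q : 'I_r -> nat) (T : R)
    (z : R -> X) (p : forall i, R -> 'rV[R]_(q i))
    (A : forall i, 'rV[R]_(q i) -> X -> X) u :
  J T z p A u = 2^-1 * L2sq T (residual z (fun i t => A i (p i t) (u.2 i)) u.1).
Proof. by []. Qed.

Lemma admissible_L2ball (R : realType) (X Y : normedModType R) (r : nat) (T C : R)
    (iota : Y -> X) u :
  0 <= C -> admissible (r := r) T C iota u -> L2ball T C u.1.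
Proof.
move=> C0 [u2 [psi psiP]]; split=> // i.
have [_ + _] := psiP i; rewrite ge_max => /andP[_].
rewrite /L2norm -/(L2sq T (fun t => u.1 t ord0 i)) => uC.
by rewrite -(sqr_sqrtr (L2sq_ge0 T (fun t => u.1 t ord0 i))) lerXn2r ?nnegrE ?sqrtr_ge0.
Qed.

Theorem theorem4p6 (R : realType)
  (* X is a separable real Hilbert space *)
  (X : completeNormedModType R) (ip : {dot X for (@idfun R)})
  (hip : forall x : X, ip x x = `|x| ^+ 2)
  (sepX : separable X)
  (* Y is a reflexive Banach space, densely and compactly embedded in X *)
  (Y : completeNormedModType R) (reflY : reflexive_space Y)
  (iota : {linear Y -> X})
  (iota_dense : dense (range iota))
  (iota_compact : compact_embedding iota)
  (T : R) (T_gt0 : 0 < T)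
  (r : nat) (q : 'I_r -> nat)
  (z : R -> X) (zL2 : L2 T z)
  (p : forall i : 'I_r, R -> 'rV[R]_(q i)) (pL2 : forall i, L2 T (p i))
  (Top : forall i : 'I_r, 'rV[R]_(q i) -> {linear X -> X})
  (Top_bounded : forall (i : 'I_r) (eta : 'rV[R]_(q i)), continuous (Top i eta))
  (* Y-invariance *)
  (Top_inv : forall (i : 'I_r) (eta : 'rV[R]_(q i)) (y : Y),
     exists y' : Y, Top i eta (iota y) = iota y')
  (* (i): the map Top i (.) y, viewed as a map g into Y, is continuous *)
  (Top_cont : forall (i : 'I_r) (y : Y) (g : 'rV[R]_(q i) -> Y),
     (forall eta, Top i eta (iota y) = iota (g eta)) -> continuous g)
  (* (ii) *)
  (Top_unif : forall i : 'I_r, exists2 cbar : R, 0 < cbar &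
     forall eta : 'rV[R]_(q i), opnorm (Top i eta) <= cbar)
  (C : R) (C_gt0 : 0 < C)
  (adm_neq0 : admissible (r := r) T C iota !=set0) :
  exists2 u, admissible T C iota u &
    forall v, admissible T C iota v -> J T z p Top u <= J T z p Top v.

Proof.
have [_ iotac _] := iota_compact.
have [c Ac] : exists c,
    forall i (eta : 'rV[R]_(q i)) x, `|Top i eta x| <= c * `|x|.
  have [b b0 bP] : exists2 b : 'I_r -> R, (forall i, 0 < b i) &
      forall i (eta : 'rV[R]_(q i)), opnorm (Top i eta) <= b i.
    have [b bP] := choice (fun i => let: ex_intro2 b b0 bP := Top_unif i in
      ex_intro (fun b => 0 < b /\ forall eta, opnorm (Top i eta) <= b) b (conj b0 bP)).
    by exists b => i; have [] := bP i.
  exists (\sum_i b i) => i eta x.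
  apply: (le_trans (le_opnorm x (linearP (Top i eta)) (@Top_bounded i eta))).
  rewrite ler_wpM2r// (le_trans (bP i eta))// (bigD1 i)//= lerDl.
  by rewrite sumr_ge0// => j _; exact: ltW.
pose G (phi : 'I_r -> X) i t := Top i (p i t) (phi i).
have mG phi (psi : 'I_r -> Y) i : phi i = iota (psi i) -> strongly_measurable `]0, T[ (G phi i).
  move=> phiE; rewrite /G phiE.
  exact: (strongly_measurable_transport _ iotac (@Top_inv i) (@Top_cont i) (pL2 i)).
have GM (phi : 'I_r -> X) i t : `|phi i| = 1 -> `|G phi i t| <= c.
  by move=> phi1; have := Ac i (p i t) (phi i); rewrite phi1 mulr1.
have GB (phi phi' : 'I_r -> X) i t : `|G phi' i t - G phi i t| <= c * `|phi' i - phi i|.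
  by rewrite /G -linearB; exact: Ac.
pose Jf := J T z p Top : _ -> R.
have J0 u : 0 <= Jf u by rewrite /Jf JE mulr_ge0// L2sq_ge0.
pose m := inf (Jf @` admissible T C iota).
have infJ : has_inf (Jf @` admissible (r := r) T C iota).
  by split; [have [u uA] := adm_neq0; exists (Jf u), u | exists 0 => _ [u _ <-]].
have m0 : 0 <= m by apply: lb_le_inf; [exact: infJ.1 | move=> _ [u _ <-]].
have near_inf n : exists u, admissible (r := r) T C iota u /\ Jf u <= m + n.+1%:R^-1.
  have n0 : 0 < n.+1%:R^-1 :> R by rewrite invr_gt0.
  by have [_ [v vA <-] /ltW Jv] := inf_adherent n0 infJ; exists v.
have [u uP] := choice near_inf.
have [psi psiP] := choice (fun n => (uP n).1.2).
(* One ultrafilter finer than the filter at infinity makes all [r] modes converge together. *)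
have [U [UU oU]] := ultraFilterLemma (eventually_filter : ProperFilter (nbhs \oo)).
have psiC i n : `|psi n i| <= C.
  by have [_ + _] := psiP n i; rewrite ge_max => /andP[].
have [y yP] := choice (fun i => let: ex_intro2 y yC yl :=
  compact_embedding_ultra_limit reflY iota_compact UU (psiC i) in
  ex_intro (fun y => `|y| <= C /\ iota (psi n i) @[n --> U] --> iota y) y (conj yC yl)).
pose phi i := iota (y i).
have phil i : (u n).2 i @[n --> U] --> phi i.
  rewrite (_ : (fun n => _) = fun n => iota (psi n i)); first exact: (yP i).2.
  by apply/funext => n; have [] := psiP n i.
(* The unit-norm constraint survives because the convergence in [X] is strong. *)
have phi1 i : `|phi i| = 1.
  apply: (cvg_unique _ (cvg_norm (phil i))) => //.
  rewrite (_ : (fun n => _) = cst 1); first exact: cvg_cst.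
  by apply/funext => n; have [] := psiP n i.
have mGphi i : strongly_measurable `]0, T[ (G phi i) by exact: (mG phi y).
have GMphi i t : `|G phi i t| <= c by exact: GM.
(* The coefficients of the minimizing sequence are not passed to the limit; an optimal [w] for the
   limit modes is taken instead. *)
have [w [w2 wC] wmin] := exists_L2ball_minimizer C zL2 mGphi GMphi.
have uA : admissible T C iota (w, phi).
  split=> //; exists y => i; split=> //; rewrite ge_max (yP i).1/=.
  rewrite /L2norm -/(L2sq T (fun t => w t ord0 i)).
  by rewrite -(ger0_norm (ltW C_gt0)) -sqrtr_sqr ler_wsqrtr.
exists (w, phi) => // v vA; apply: (@le_trans _ _ m); last first.
  by apply: ge_inf; [exact: infJ.2 | exists v].
apply: le_of_le_1DM => // d d0.
pose e n := 2 ^+ r * \sum_(i < r) (c * `|(u n).2 i - phi i|) ^+ 2 * C ^+ 2.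
(* The coefficients of [u n] compete with [w] at the modes [phi]; moving then from [phi] to the
   modes of [u n] costs the factor [1 + d] and the error [e n]. *)
have Jle n : Jf (w, phi) <= (1 + d) * (m + n.+1%:R^-1) + 2^-1 * ((1 + d^-1) * e n).
  have [un2 [_ Jn]] := (admissible_L2ball (ltW C_gt0) (uP n).1, uP n).
  have phin1 i : `|(u n).2 i| = 1 by have [] := psiP n i.
  have phinE i : (u n).2 i = iota (psi n i) by have [] := psiP n i.
  have pert := @L2sq_residual_perturb _ T X r z (G phi) (G (u n).2) (u n).1 C c d
    (fun i => c * `|(u n).2 i - phi i|) zL2 un2 mGphi GMphi
    (fun i => mG _ _ _ (phinE i)) (fun i t => GM _ _ t (phin1 i))
    (fun i t => GB _ _ i t) d0.
  have {pert} := le_trans (wmin _ un2) pert; rewrite -/(e n) => wn.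
  move: Jn; rewrite /Jf !JE/= -/(G phi) -/(G (u n).2) => Jn.
  move: wn; rewrite -(@ler_pM2l _ (2^-1 : R))// => /le_trans; apply.
  by rewrite [leLHS]mulrDr lerD2r mulrCA ler_wpM2l// addr_ge0// ltW.
have dl i : `|(u n).2 i - phi i| @[n --> U] --> (0 : R).
  rewrite -(@normr0 _ X) -(subrr (phi i)); apply: cvg_norm.
  by apply: cvgB; [exact: phil | exact: cvg_cst].
have el : e n @[n --> U] --> (0 : R).
  rewrite (_ : 0 = 2 ^+ r * \sum_(i < r) (c * 0) ^+ 2 * C ^+ 2); last first.
    rewrite big1 => [|i _]; first by rewrite mulr0.
    by rewrite mulr0 expr0n/= mul0r.
  apply: cvgMl_tmp; apply: cvg_big => [|i _]; first exact: add_continuous.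
  apply: cvgMr_tmp; apply: (continuous_cvg _ (@exprn_continuous R 2 _)).
  by apply: cvgMl_tmp; exact: dl.
have hl : n.+1%:R^-1 @[n --> U] --> (0 : R) := cvg_trans (cvg_app _ oU) (@cvg_harmonic R).
have rhsl : (1 + d) * (m + n.+1%:R^-1) + 2^-1 * ((1 + d^-1) * e n) @[n --> U] -->
    (1 + d) * (m + 0) + 2^-1 * ((1 + d^-1) * 0).
  apply: cvgD; last by apply: cvgMl_tmp; exact: cvgMl_tmp.
  by apply: cvgMl_tmp; apply: cvgD => //; exact: cvg_cst.
rewrite (_ : (1 + d) * m = (1 + d) * (m + 0) + 2^-1 * ((1 + d^-1) * 0)).
  by apply: (cvgr_to_ge rhsl); exact: nearW.
by rewrite !mulr0 !addr0.
Qed.
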